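(* If $\mathcal{C}$ is a clone of Boolean functions different from $\{\operatorname{id}\}$, $\{0,\operatorname{id}\}$, $\{1,\operatorname{id}\}$, $\{0,1,\operatorname{id}\}$, $\Omega$, $\Omega_{0\ast}$, $\Omega_{\ast1}$, $L$, $L_{0\ast}$, $L_{\ast1}$, $W^{2},W^3,\ldots,W^{\infty}$, $U^{2},U^3,\ldots,U^{\infty}$, then $\mathbf{I}(\mathcal{C})=\{\mathcal{C}\}$.
   Context: $\Omega$ is the set of all Boolean functions $f\colon\{0,1\}^n\to\{0,1\}$, $n\ge 1$. An $m$-ary $g$ is a subfunction of an $n$-ary $f$ if there is a map $\sigma\colon\{1,\dots,n\}\to\{1,\dots,m\}$ with $g(x_1,\dots,x_m)=f(x_{\sigma(1)},\dots,x_{\sigma(n)})$ identically. An equational class is a set $\mathcal{K}\subseteq\Omega$ (possibly empty) such that every subfunction of a member of $\mathcal{K}$ is in $\mathcal{K}$. For an $n$-ary $f$ and $k$-ary $g_1,\dots,g_n$, the composition $f(g_1,\dots,g_n)$ is the $k$-ary function $\mathbf{a}\mapsto f(g_1(\mathbf{a}),\dots,g_n(\mathbf{a}))$; $\mathcal{K}$ is composition-closed if all compositions $f(g_1,\dots,g_n)$ with $f,g_1,\dots,g_n\in\mathcal{K}$ ($g_i$ of equal arity) belong to $\mathcal{K}$. A clone is a composition-closed subset of $\Omega$ containing all projections; $[\mathcal{K}]$ is the smallest clone containing $\mathcal{K}$. $\mathbf{I}$ is the set of all composition-closed equational classes, and $\mathbf{I}(\mathcal{C})=\{\mathcal{K}\in\mathbf{I}:[\mathcal{K}]=\mathcal{C}\}$.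 Functions differing only in inessential variables or in the order of variables are not distinguished: in the listed classes, $\operatorname{id}$ stands for all projections (of all arities), and $0$, $1$ stand for all constant $0$, respectively constant $1$, functions. $\Omega_{0\ast}=\{f:f(\mathbf{0})=0\}$, $\Omega_{\ast1}=\{f:f(\mathbf{1})=1\}$, where $\mathbf{0},\mathbf{1}$ are the constant tuples. $L$ is the set of linear functions, i.e. sums modulo $2$ of some (possibly zero) variables plus a constant $c\in\{0,1\}$; $L_{0\ast}=L\cap\Omega_{0\ast}$, $L_{\ast1}=L\cap\Omega_{\ast1}$. An $n$-ary $f$ preserves a relation $P\subseteq\{0,1\}^k$ if applying $f$ coordinatewise to any $n$ members of $P$ gives a member of $P$. For finite $k\ge2$, $W^k$ is the clone of functions preserving $\{0,1\}^k\setminus\{\mathbf{0}\}$, and $W^\infty=\bigcap_{k\ge2}W^k$. For $k\in\{2,3,\ldots,\infty\}$, $U^k$ is the dual of $W^k$, i.e. the set of functions $\lnot f(\lnot x_1,\dots,\lnot x_n)$ with $f\in W^k$. *)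

(* Defs.v *)
From mathcomp Require Import all_boot all_classical.

Set Implicit Arguments.
Unset Strict Implicit.
Unset Printing Implicit Defensive.

Local Open Scope classical_set_scope.

Definition bfun (n : nat) := {ffun {ffun 'I_n -> bool} -> bool}.

(* Arities are at least 1: the tag is the arity minus one. *)
Definition Omega := {n : nat & bfun n.+1}.

Definition fn (n : nat) (f : bfun n.+1) : Omega := existT (fun n => bfun n.+1) n f.

Definition arity (f : Omega) : nat := (projT1 f).+1.

Definition op (f : Omega) : bfun (arity f) := projT2 f.

Definition subfunction (m n : nat) (g : bfun m) (f : bfun n) : Prop :=
  exists sigma : 'I_n -> 'I_m,
    forall x : {ffun 'I_m -> bool}, g x = f [ffun i => x (sigma i)].

Definition equational (K : set Omega) : Prop :=
  forall (m n : nat) (g : bfun m.+1) (f : bfun n.+1),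
    subfunction g f -> K (fn f) -> K (fn g).

Definition composition (n k : nat) (f : bfun n) (g : 'I_n -> bfun k) : bfun k :=
  [ffun a => f [ffun i => g i a]].

Definition composition_closed (K : set Omega) : Prop :=
  forall (n k : nat) (f : bfun n.+1) (g : 'I_n.+1 -> bfun k.+1),
    K (fn f) -> (forall i, K (fn (g i))) -> K (fn (composition f g)).

Definition projection (n : nat) (i : 'I_n) : bfun n :=
  [ffun x : {ffun 'I_n -> bool} => x i].

Definition projections : set Omega :=
  [set f | exists (n : nat) (i : 'I_n.+1), f = fn (projection i)].

Definition constants (c : bool) : set Omega :=
  [set f | exists n : nat, f = fn ([ffun=> c] : bfun n.+1)].

Definition clone (C : set Omega) : Prop :=
  composition_closed C /\ projections `<=` C.

Definition generated_clone (K : set Omega) : set Omega := smallest clone K.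

Definition closed_classes : set (set Omega) :=
  [set K | equational K /\ composition_closed K].

Definition closed_classes_of (C : set Omega) : set (set Omega) :=
  [set K | closed_classes K /\ generated_clone K = C].

Definition Omega_0s : set Omega := [set f | op f [ffun=> false] = false].
Definition Omega_s1 : set Omega := [set f | op f [ffun=> true] = true].

Definition L : set Omega :=
  [set f | exists (S : {set 'I_(arity f)}) (c : bool),
     forall x, op f x = (\big[addb/false]_(i in S) x i) (+) c].

Definition L_0s : set Omega := L `&` Omega_0s.
Definition L_s1 : set Omega := L `&` Omega_s1.

Definition preserves (n k : nat) (f : bfun n) (P : set {ffun 'I_k -> bool}) : Prop :=
  forall r : 'I_n -> {ffun 'I_k -> bool},
    (forall i, P (r i)) -> P [ffun j => f [ffun i => r i j]].

Definition W (k : nat) : set Omega :=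
  [set f | preserves (op f) (~` [set [ffun=> false] : {ffun 'I_k -> bool}])].

Definition W_inf : set Omega := \bigcap_(k in [set k : nat | 2 <= k]) W k.

Definition dual (f : Omega) : Omega :=
  fn [ffun x : {ffun 'I_(arity f) -> bool} => ~~ op f [ffun i => ~~ x i]].

Definition U (k : nat) : set Omega := dual @` W k.
Definition U_inf : set Omega := dual @` W_inf.

(* Main.v *)
Require Import Defs.
From mathcomp Require Import all_boot all_classical.

Set Implicit Arguments.
Unset Strict Implicit.

Local Open Scope classical_set_scope.

(** Let [K] be a composition-closed equational class generating the clone [C].
If [K] contains a projection it contains all of them, so it is a clone and
equals [C].  Otherwise the unary function obtained from a member [f] of [K] by
identifying all variables is neither the identity nor (since the negation
composed with itself is the identity) the negation; hence every [f] in [K] has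
the same value at the all-zero and at the all-one tuple
([no_projection_diagonal]).  If [K] has constants only, [C] is one of the four
clones made of projections and constants ([generated_by_constants]).

There remains the case where [C] contains a nonconstant [f] with equal values
at the two constant tuples.  Up to duality this common value is 0.  Substituting
only two variables [u], [v] for the variables of [f], according to a point where
[f] is 1, gives a binary operation that vanishes at (0,0) and (1,1) and is 1 at
(0,1): it is either [~~ u && v] or addition modulo 2 ([nonconstant_clone]).

- A clone with [~~ u && v] contains every function lying below a variable
  ([below_variable_in]).  If all members of [C] vanish at the all-zero tuple,
  take the least [k >= 2] such that [C] is not included in [U k], and a member of
  [C] with [k] true points that have no common coordinate equal to 1.  That member
  allows every function of [U (k - 1)] to be built from functions with fewer true
  points ([meeting_in]), so [C] is squeezed to [U (k - 1)], or to [Omega_0s] when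
  [k = 2].  If there is no such [k], [C] is [U_inf].  If some member of [C] is 1
  at the all-zero tuple, [C] contains the constant 1 and is everything.
- A clone with addition contains [L_0s].  If it has only linear members it is
  [L_0s] or [L]; a nonlinear member yields conjunction, hence [~~ u && v], and the
  first case applies.

Every clone so reached is among those excluded. *)

(** * Clones and the binary operations they are closed under *)

Lemma clone_comp (C : set Omega) (n k : nat) (f : bfun n.+1)
    (h : 'I_n.+1 -> bfun k.+1) (g : bfun k.+1) :
  clone C -> C (fn f) -> (forall i, C (fn (h i))) ->
  (forall x, g x = f [ffun i => h i x]) -> C (fn g).
Proof.
move=> [CC _] Cf Ch gE.
suff -> : g = composition f h by exact: CC.
by apply/ffunP => x; rewrite ffunE gE.
Qed.

Lemma clone_projection (C : set Omega) (n : nat) (i : 'I_n.+1) :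
  clone C -> C (fn (projection i)).
Proof. by move=> [_]; apply; exists n, i. Qed.

Lemma clone_equational (C : set Omega) : clone C -> equational C.
Proof.
move=> cC m n g f [s gE] Cf.
apply: (clone_comp (h := fun i => projection (s i)) cC Cf) => [i|x].
  exact: clone_projection.
by rewrite gE; congr (f _); apply/ffunP => i; rewrite !ffunE.
Qed.

(** Closure under pointwise application of a binary operation.  For a clone this
amounts to containing the operation as a binary function, but this form composes
without any manipulation of arities and variable indices. *)
Definition closed_op (C : set Omega) (o : bool -> bool -> bool) : Prop :=
  forall (n : nat) (g h : bfun n.+1), C (fn g) -> C (fn h) ->
    C (fn ([ffun x => o (g x) (h x)] : bfun n.+1)).

Lemma closed_op_ext (C : set Omega) (o p : bool -> bool -> bool) :
  (forall u v, o u v = p u v) -> closed_op C o -> closed_op C p.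
Proof.
move=> op_eq Co n g h Cg Ch; have := Co n g h Cg Ch.
by congr (C (fn _)); apply/ffunP => x; rewrite !ffunE.
Qed.

Lemma closed_op_left (C : set Omega) : closed_op C (fun u _ => u).
Proof.
move=> n g h Cg _; suff -> : [ffun x => g x] = g by [].
by apply/ffunP => x; rewrite ffunE.
Qed.

Lemma closed_op_right (C : set Omega) : closed_op C (fun _ v => v).
Proof. by move=> n g h Cg Ch; exact: (@closed_op_left C n h g). Qed.

Lemma closed_op_comp2 (C : set Omega) (o p q : bool -> bool -> bool) :
  closed_op C o -> closed_op C p -> closed_op C q ->
  closed_op C (fun u v => o (p u v) (q u v)).
Proof.
move=> Co Cp Cq n g h Cg Ch.
have := Co n _ _ (Cp n g h Cg Ch) (Cq n g h Cg Ch).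
by congr (C (fn _)); apply/ffunP => x; rewrite !ffunE.
Qed.

Lemma closed_op_subst (C : set Omega) (n : nat) (f : bfun n.+1)
    (o : 'I_n.+1 -> bool -> bool -> bool) :
  clone C -> C (fn f) -> (forall i, closed_op C (o i)) ->
  closed_op C (fun u v => f [ffun i => o i u v]).
Proof.
move=> cC Cf Co k g h Cg Ch.
apply: (clone_comp cC Cf (fun i => Co i k g h Cg Ch)) => x.
by rewrite ffunE; congr (f _); apply/ffunP => i; rewrite !ffunE.
Qed.

Lemma constant_true_in (C : set Omega) (n m : nat) (f : bfun n.+1) :
  clone C -> C (fn ([ffun=> false] : bfun m.+1)) -> C (fn f) ->
  f [ffun=> false] -> C (fn ([ffun=> true] : bfun m.+1)).
Proof.
move=> cC C0 Cf f0; apply: (clone_comp cC Cf (fun=> C0)) => x.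
rewrite ffunE -f0; congr (f _).
by apply/ffunP => i; rewrite !ffunE.
Qed.

(** * Clones closed under the operation u < v *)

Definition nlt (u v : bool) : bool := ~~ u && v.

(** Inside the Boolean algebra of functions below the variable [x i], the
operation [nlt] gives the relative complement [x i && ~~ h x] and with it
conjunction; so all functions [x i && h x] arise, starting from the [x i && x j],
by writing [h] as a disjunction of minterms. *)
Lemma below_variable_in (C : set Omega) (n : nat) (i : 'I_n.+1)
    (g : bfun n.+1) :
  clone C -> closed_op C nlt ->
  (forall x : {ffun _ -> bool}, g x -> x i) -> C (fn g).
Proof.
move=> cC Cnlt gi.
(* [P h]: the part of [h] below the variable [x i] belongs to [C]. *)
pose P (h : {ffun 'I_n.+1 -> bool} -> bool) :=
  C (fn ([ffun x : {ffun _ -> bool} => x i && h x] : bfun n.+1)).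
have Pext h h' : (forall x, h x = h' x) -> P h -> P h'.
  by move=> hh'; rewrite /P; congr (C (fn _)); apply/ffunP => x; rewrite !ffunE hh'.
have Pvar j : P (fun x => x j).
  have Cand : closed_op C (fun u v => u && v).
    apply: closed_op_ext (closed_op_comp2 Cnlt
      (closed_op_comp2 Cnlt (@closed_op_right C) (@closed_op_left C))
      (@closed_op_left C)).
    by case; case.
  have := Cand n _ _ (clone_projection i cC) (clone_projection j cC).
  by congr (C (fn _)); apply/ffunP => x; rewrite !ffunE.
have Pnlt h h' : P h -> P h' -> P (fun x => nlt (h x) (h' x)).
  move=> Ph Ph'; have := Cnlt n _ _ Ph Ph'.
  by congr (C (fn _)); apply/ffunP => x; rewrite !ffunE; case: (x i).
have Pnot h : P h -> P (fun x => ~~ h x).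
  move=> Ph; have := Cnlt n _ _ Ph (Pvar i).
  by congr (C (fn _)); apply/ffunP => x; rewrite !ffunE /nlt; case: (x i); case: (h x).
have Pand h h' : P h -> P h' -> P (fun x => h x && h' x).
  move=> Ph Ph'; apply: Pext (Pnlt _ _ (Pnot _ Ph) Ph') => x.
  by rewrite /nlt negbK.
have Ptrue : P (fun=> true).
  by have := Pvar i; congr (C (fn _)); apply/ffunP => x; rewrite !ffunE andbb andbT.
have Ppoint a : P (fun x => x == a).
  have Pall s : P (fun x => all (fun j => x j == a j) s).
    elim: s => //= j s IHs; apply: (Pand (fun x => x j == a j)) => //.
    case aj: (a j); first by apply: Pext (Pvar j) => x; rewrite eqb_id.
    by apply: Pext (Pnot _ (Pvar j)) => x; rewrite eqbF_neg.
  apply: Pext (Pall (enum 'I_n.+1)) => x; apply/allP/eqP => [xa|-> //].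
  by apply/ffunP => j; apply/eqP/xa; rewrite mem_enum.
have Pmem (s : seq {ffun 'I_n.+1 -> bool}) : P (fun x => x \in s).
  elim: s => [|a s IHs]; first exact: Pext (Pnot _ Ptrue).
  apply: Pext (Pnot _ (Pand _ _ (Pnot _ (Ppoint a)) (Pnot _ IHs))) => x.
  by rewrite inE negb_and !negbK.
have := Pmem (enum [pred x | g x]).
congr (C (fn _)); apply/ffunP => x; rewrite !ffunE mem_enum inE.
by apply/andb_idl/gi.
Qed.

(** Any [k] true points of [g] share a coordinate equal to 1.  By [U_meeting]
below this is membership in [U k]; for [k = 1] it says that [g] vanishes at the
all-zero tuple. *)
Definition meeting (k n : nat) (g : bfun n) : Prop :=
  forall t : 'I_k -> {ffun 'I_n -> bool},
    (forall l, g (t l)) -> exists i, forall l, t l i.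

(** When [k] points suffice to list all true points of [g], the condition gives
one coordinate that works for all of them at once. *)
Lemma meeting_bound (k n : nat) (g : bfun n.+1) :
  meeting k g -> #|[pred x | g x]| <= k ->
  exists i, forall x : {ffun _ -> bool}, g x -> x i.
Proof.
move=> gk Tk.
have [x0 gx0|T0] := pickP [pred x | g x]; last first.
  by exists ord0 => x; have /= -> := T0 x.
have [l|i ti] := gk (fun l => nth x0 (enum [pred x | g x]) l).
  have /= [lT|Tl] := ltnP l (size (enum [pred x | g x])); last first.
    by rewrite nth_default.
  by have := mem_nth x0 lT; rewrite mem_enum.
exists i => x gx.
have xT : x \in enum [pred x | g x] by rewrite mem_enum.
have lk : index x (enum [pred x | g x]) < k.
  by apply: leq_trans Tk; rewrite cardE index_mem.
by have := ti (Ordinal lk); rewrite /= nth_index.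
Qed.

(** The points [a l] witness that [f] does not satisfy [meeting k.+1].  The proof
is by induction on the number of true points of [g].  If [g] has at most [k] true
points, it lies below a variable.  Otherwise choose [k.+1] of its true points and
write [g] as [f] applied to functions [h j] below [g]: at the [l]-th chosen point
they take the values [a l], at the other true points of [g] the values of some
[a l], and elsewhere 0, so that [f] returns 1 exactly where [g] does.  Since column
[j] of [a] contains a 0, [h j] misses at least one chosen point and has fewer true
points than [g]. *)
Lemma meeting_in (C : set Omega) (n k : nat) (f : bfun n.+1)
    (a : 'I_k.+1 -> {ffun 'I_n.+1 -> bool}) :
  clone C -> closed_op C nlt -> C (fn f) -> f [ffun=> false] = false ->
  (forall l, f (a l)) -> (forall j, exists l, ~~ a l j) ->
  forall (m : nat) (g : bfun m.+1), meeting k g -> C (fn g).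
Proof.
move=> cC Cnlt Cf f0 fa aj m g.
have [b] := ubnP #|[pred x | g x]|; elim: b g => // b IHb g gb gk.
have [kT|Tk] := ltnP k #|[pred x | g x]|; last first.
  have [i gi] := meeting_bound gk Tk; exact: below_variable_in gi.
pose T := enum [pred x | g x].
(* The [l]-th chosen point is the [l]-th entry of [T]; [inord] sends the indices
   larger than [k] to 0, so the other true points use [a ord0]. *)
pose h j : bfun m.+1 := [ffun x => g x && a (inord (index x T)) j].
apply: (clone_comp (h := h) cC Cf) => [j|x]; last first.
  case gx: (g x); last first.
    by rewrite -f0; congr (f _); apply/ffunP => j; rewrite !ffunE gx.
  rewrite -[LHS](fa (inord (index x T))); congr (f _).
  by apply/ffunP => j; rewrite !ffunE gx.
apply: IHb; last first.
  by move=> t ht; apply: gk => l; have := ht l; rewrite ffunE => /andP[].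
rewrite -ltnS; apply: leq_trans gb; rewrite ltnS.
apply: proper_card; apply/properP; split.
  by apply/fintype.subsetP => x; rewrite !inE ffunE => /andP[].
have [l alj] := aj j.
have lT : l < size T by rewrite -cardE (leq_trans _ kT).
have [x0 _] : exists x, x \in [pred x | g x] by apply/card_gt0P/leq_trans/kT.
exists (nth x0 T l); first by have := mem_nth x0 lT; rewrite mem_enum.
rewrite inE ffunE index_uniq ?enum_uniq // negb_and inord_val.
by rewrite alj orbT.
Qed.

(** * Duality *)

Lemma dualK : involutive dual.
Proof.
case=> n f; rewrite /dual /=; congr (fn _); apply/ffunP => x.
rewrite !ffunE negbK; congr (f _); apply/ffunP => i.
by rewrite !ffunE negbK.
Qed.

Lemma mem_dual (A : set Omega) (f : Omega) : (dual @` A) f <-> A (dual f).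
Proof.
split=> [[g Ag <-]|Af]; first by rewrite dualK.
by exists (dual f); rewrite ?dualK.
Qed.

Lemma eq_dual (A B : set Omega) : dual @` A = B -> A = dual @` B.
Proof.
by move=> <-; apply/seteqP; split=> f; rewrite !mem_dual dualK.
Qed.

Lemma dual_clone (C : set Omega) : clone C -> clone (dual @` C).
Proof.
move=> cC; split=> [n k f g /mem_dual Cf Cg|_ [n [i ->]]]; apply/mem_dual.
  apply: (clone_comp cC Cf (fun i => (mem_dual _ _).1 (Cg i))) => x.
  rewrite !ffunE; congr (~~ f _); apply/ffunP => i.
  by rewrite !ffunE negbK.
have := clone_projection i cC; congr (C (fn _)); apply/ffunP => x.
by rewrite !ffunE negbK.
Qed.

(** * The clones above U_inf *)

Lemma U_meeting (k n : nat) (g : bfun n.+1) : U k (fn g) <-> meeting k g.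
Proof.
rewrite /U mem_dual; split=> [Wg t gt|gk r r0 rE].
  apply: contrapT => nt.
  pose r (i : 'I_n.+1) : {ffun 'I_k -> bool} := [ffun l => ~~ t l i].
  apply: (Wg r) => [i ri|].
    by apply: nt; exists i => l; have /ffunP/(_ l) := ri; rewrite !ffunE => /negbFE.
  apply/ffunP => l; rewrite !ffunE; apply/negbTE; rewrite negbK.
  have := gt l; congr (is_true (g _)); apply/ffunP => i.
  by rewrite !ffunE negbK.
have [l|i ti] := gk (fun l => [ffun i => ~~ r i l]).
  have /ffunP/(_ l) := rE; rewrite !ffunE => /negbFE; congr (is_true (g _)).
  by apply/ffunP => i; rewrite !ffunE.
apply: (r0 i); apply/ffunP => l; have := ti l; rewrite !ffunE => /negbTE //.
Qed.

Lemma U_inf_variable (n : nat) (g : bfun n.+1) :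
  U_inf (fn g) <-> exists i, forall x : {ffun _ -> bool}, g x -> x i.
Proof.
have -> : U_inf (fn g) <-> forall k, 2 <= k -> meeting k g.
  rewrite /U_inf mem_dual; split=> Wg k k2.
    by apply/U_meeting/mem_dual/Wg.
  by apply/mem_dual/U_meeting/Wg.
split=> [gk|[i gi] k _ t gt]; last by exists i => l; apply/gi/gt.
pose k := maxn 2 #|[pred x | g x]|.
by apply: (meeting_bound (gk k (leq_maxl _ _))); exact: leq_maxr.
Qed.

(** The exceptional clones that can contain a nonconstant function vanishing at
both constant tuples; every other exceptional clone with members besides
projections and constants is the dual of one of them. *)
Definition zero_type : set (set Omega) :=
  [set C | [\/ C = setT, C = Omega_0s, C = L | C = L_0s] \/
           (exists2 k, 2 <= k & C = U k) \/ C = U_inf].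

(** The constant 1 belongs to [C], and any [g] is the function [x_0 && g], which
lies below the extra variable [x_0], with 1 substituted for [x_0]. *)
Lemma nlt_clone_true (C : set Omega) :
  clone C -> closed_op C nlt -> ~ (C `<=` Omega_0s) -> C = setT.
Proof.
move=> cC Cnlt /existsNP[[n f] /not_implyP[Cf f0]].
have {}f0 : f [ffun=> false] by apply: contrapT => /negP/negbTE.
apply/seteqP; split=> // -[m g] _.
have C0 (k : nat) : C (fn ([ffun=> false] : bfun k.+1)).
  by apply: (below_variable_in (i := ord0)) => // x; rewrite ffunE.
have C1 := constant_true_in cC (C0 m) Cf f0.
pose g' : bfun m.+2 := [ffun x : {ffun _ -> bool} =>
  x ord0 && g [ffun i => x (lift ord0 i)]].
have Cg' : C (fn g').
  by apply: (below_variable_in (i := ord0)) => // x; rewrite ffunE => /andP[].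
pose h (j : 'I_m.+2) : bfun m.+1 :=
  if unlift ord0 j is Some i then projection i else [ffun=> true].
apply: (clone_comp (h := h) cC Cg') => [j|x].
  by rewrite /h; case: unlift => [i|//]; exact: clone_projection.
rewrite !ffunE /h unlift_none ffunE /=; congr (g _); apply/ffunP => i.
by rewrite !ffunE liftK ffunE.
Qed.

Lemma nlt_clone (C : set Omega) : clone C -> closed_op C nlt -> zero_type C.
Proof.
move=> cC Cnlt.
have [C0|] := pselect (C `<=` Omega_0s); last first.
  by move=> nC0; left; constructor 1; exact: nlt_clone_true.
have [CU|] := pselect (forall k, 2 <= k -> C `<=` U k).
  right; right; apply/seteqP; split=> [f Cf|[n g] /U_inf_variable[i gi]].
    by apply/mem_dual => k k2; apply/mem_dual/CU.
  exact: below_variable_in gi.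
move=> /existsNP[k0 /not_implyP[k02 CUk0]].
pose bad k := (2 <= k) && ~~ `[< C `<=` U k >].
have exbad : exists k, bad k by exists k0; rewrite /bad k02; exact/asboolPn.
(* Minimality of [k.+1] gives [C `<=` U k] as soon as [2 <= k]; for [k = 1] the
   role of [U 1] is played by [Omega_0s]. *)
case: (ex_minnP exbad) => -[//|k] /andP[k2 /asboolPn CUk] kmin.
move: (CUk) => /existsNP[[n f]] /not_implyP[Cf /U_meeting nf].
move: nf => /existsNP[a /not_implyP[fa /forallNP na]].
have f0 : f [ffun=> false] = false by exact: (C0 _ Cf).
have aj j : exists l, ~~ a l j.
  move: (na j) => /existsNP[l /negP al]; by exists l.
have inC := meeting_in cC Cnlt Cf f0 fa aj.
have [k1|k2'] := ltnP k 2.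
  left; constructor 2; apply/seteqP; split=> // -[m g] g0; apply: inC => t gt.
  have {k2} k0k : 0 < k by [].
  have {k1} k1 : k = 1 by apply/eqP; rewrite eqn_leq -ltnS k1 k0k.
  subst k; apply: contrapT => /forallNP nt.
  have := gt ord0; suff -> : t ord0 = [ffun=> false] by rewrite [g _]g0.
  apply/ffunP => i; rewrite ffunE; apply/negbTE/negP => ti.
  by apply: (nt i) => l; rewrite (ord1 l).
right; left; exists k => //; apply/seteqP; split=> [f' Cf'|[m g] /U_meeting].
  apply: contrapT => nf'; suff : k < k by rewrite ltnn.
  apply: kmin; rewrite /bad k2'; apply/asboolPn => CU; exact/nf'/CU.
exact: inC.
Qed.

(** * Clones closed under addition *)

(** A map of vector spaces over the two-element field that is additive up to its
value at 0 is affine: its linear part is determined by the unit vectors, whose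
values select the variables of the sum. *)
Lemma affine_linear (n : nat) (f : bfun n.+1) :
  (forall a b : {ffun 'I_n.+1 -> bool}, f [ffun i => a i (+) b i] =
     f a (+) f b (+) f [ffun=> false]) -> L (fn f).
Proof.
move=> faff; set z := f [ffun=> false].
pose e (i : 'I_n.+1) : {ffun 'I_n.+1 -> bool} := [ffun j => j == i].
exists [set i | f (e i) (+) z]%SET, z => x /=.
(* Coordinates of [x] are switched on one at a time. *)
have restrict (s : seq 'I_n.+1) : uniq s -> f [ffun i => (i \in s) && x i] =
    (\big[addb/false]_(i <- s | f (e i) (+) z) x i) (+) z.
  elim: s => [_|i s IHs /andP[iNs us]].
    by rewrite big_nil; congr (f _); apply/ffunP => i; rewrite !ffunE.
  rewrite big_cons.
  have -> : [ffun j => (j \in i :: s) && x j] =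
      [ffun j => [ffun j => (j == i) && x i] j (+) [ffun j => (j \in s) && x j] j].
    apply/ffunP => j; rewrite !ffunE inE; case: eqP => [->|_] //=.
    by rewrite (negbTE iNs) addbF.
  rewrite faff (IHs us) -/z.
  have -> : f [ffun j => (j == i) && x i] = ((f (e i) (+) z) && x i) (+) z.
    case xi: (x i).
      rewrite andbT -addbA addbb addbF; congr (f _).
      by apply/ffunP => j; rewrite !ffunE andbT.
    by rewrite andbF; congr (f _); apply/ffunP => j; rewrite !ffunE andbF.
  move: (\big[addb/false]_(j <- s | f (e j) (+) z) x j) => y.
  by case: (f (e i) (+) z); case: (x i); case: y; case: (z).
rewrite -[LHS](_ : f [ffun i => (i \in enum 'I_n.+1) && x i] = _); last first.
  by congr (f _); apply/ffunP => i; rewrite ffunE mem_enum.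
rewrite restrict ?enum_uniq // big_enum_cond; congr (_ (+) _).
by rewrite /=; apply: eq_bigl => i; rewrite inE.
Qed.

Lemma addb_constant_false (C : set Omega) (n : nat) :
  clone C -> closed_op C addb -> C (fn ([ffun=> false] : bfun n.+1)).
Proof.
move=> cC Cadd; have Cp := clone_projection (ord0 : 'I_n.+1) cC.
have := Cadd n _ _ Cp Cp.
by congr (C (fn _)); apply/ffunP => x; rewrite !ffunE addbb.
Qed.

Lemma L_0s_in (C : set Omega) : clone C -> closed_op C addb -> L_0s `<=` C.
Proof.
move=> cC Cadd [n f] [[S [c fE]] f0].
have {f0} c0 : c = false.
  by rewrite -[RHS](f0 : _ = _) fE big1 // => i _; rewrite ffunE.
have sum s : C (fn ([ffun x : {ffun _ -> bool} =>
    \big[addb/false]_(i <- s | i \in (S : {set 'I_n.+1})) x i] : bfun n.+1)).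
  elim: s => [|i s IHs].
    have := addb_constant_false n cC Cadd.
    by congr (C (fn _)); apply/ffunP => x; rewrite !ffunE big_nil.
  case iS: (i \in S); last first.
    by move: IHs; congr (C (fn _)); apply/ffunP => x; rewrite !ffunE big_cons iS.
  have := Cadd n _ _ (clone_projection i cC) IHs.
  by congr (C (fn _)); apply/ffunP => x; rewrite !ffunE big_cons iS.
have := sum (index_enum 'I_n.+1); congr (C (fn _)).
by apply/ffunP => x; rewrite ffunE [f x]fE c0 addbF.
Qed.

Lemma addb_clone_true (C : set Omega) (n : nat) :
  clone C -> closed_op C addb -> ~ (C `<=` Omega_0s) ->
  C (fn ([ffun=> true] : bfun n.+1)).
Proof.
move=> cC Cadd /existsNP[[m f] /not_implyP[Cf f0]].
apply: (constant_true_in cC (addb_constant_false n cC Cadd) Cf).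
by apply: contrapT => /negP/negbTE.
Qed.

(** If [a], [b] witness that [f] is not affine, then [f] restricted to the span of
[a] and [b], that is [o u v = f (u a + v b)], has polynomial
[u v + alpha u + beta v + gamma] over the two-element field.  Adding suitable
multiples of [u], [v] and the constant leaves [u v + v], which is [nlt u v]. *)
Lemma addb_clone_nonlinear (C : set Omega) :
  clone C -> closed_op C addb -> ~ (C `<=` L) -> closed_op C nlt.
Proof.
move=> cC Cadd /existsNP[[n f] /not_implyP[Cf nLf]].
have /existsNP[a /existsNP[b fab]] : ~ forall a b : {ffun 'I_n.+1 -> bool},
    f [ffun i => a i (+) b i] = f a (+) f b (+) f [ffun=> false].
  by move=> /affine_linear.
have C0 : closed_op C (fun _ _ => false).
  by move=> m g h _ _; exact: addb_constant_false.
have Cl := @closed_op_left C; have Cr := @closed_op_right C.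
pose o u v := f [ffun i => (a i && u) (+) (b i && v)].
have Co : closed_op C o.
  apply: (closed_op_subst cC Cf) => i; apply: (closed_op_comp2 Cadd).
    by case: (a i) => //=; apply: closed_op_ext Cl.
  by case: (b i) => //=; apply: closed_op_ext Cr.
have Cq : closed_op C (fun u v => o u v (+) o false false).
  apply: closed_op_comp2 Cadd Co (closed_op_comp2 Co C0 C0).
have oE : o true true != o true false (+) o false true (+) o false false.
  apply/eqP => E; apply: fab.
  have <- : o true true = f [ffun i => a i (+) b i].
    by congr (f _); apply/ffunP => i; rewrite !ffunE !andbT.
  have <- : o true false = f a.
    by congr (f _); apply/ffunP => i; rewrite !ffunE andbT andbF addbF.
  have <- : o false true = f b.
    by congr (f _); apply/ffunP => i; rewrite !ffunE andbT andbF.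
  have <- // : o false false = f [ffun=> false].
  by congr (f _); apply/ffunP => i; rewrite !ffunE !andbF.
have Cmul c p : closed_op C p -> closed_op C (fun u v => c && p u v).
  by case: c => //= _; exact: C0.
have := closed_op_comp2 Cadd (closed_op_comp2 Cadd Cq
  (Cmul (o true false (+) o false false) _ Cl))
  (Cmul (~~ (o false true (+) o false false)) _ Cr).
apply: closed_op_ext => u v; move: oE.
by case: u; case: v => /=; case: (o true true); case: (o true false);
  case: (o false true); case: (o false false).
Qed.

Lemma addb_clone (C : set Omega) : clone C -> closed_op C addb -> zero_type C.
Proof.
move=> cC Cadd.
have [CL|nCL] := pselect (C `<=` L); last first.
  exact: nlt_clone cC (addb_clone_nonlinear cC Cadd nCL).
have L0C := L_0s_in cC Cadd.
have [C0|nC0] := pselect (C `<=` Omega_0s).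
  left; constructor 4; apply/seteqP; split=> // f Cf.
  by split; [exact: CL|exact: C0].
left; constructor 3; apply/seteqP; split=> // -[n f] Lf.
have C1 := addb_clone_true n cC Cadd nC0.
case f0: (f [ffun=> false]); last by apply: L0C; split.
have Cf' : C (fn ([ffun x => ~~ f x] : bfun n.+1)).
  apply: L0C; split; last by rewrite /Omega_0s /= /op /= ffunE f0.
  have [S [c fE]] := Lf; exists S, (~~ c) => x.
  by rewrite [LHS]ffunE [f x]fE addbN.
have := Cadd n _ _ Cf' C1; congr (C (fn _)).
by apply/ffunP => x; rewrite !ffunE addbT negbK.
Qed.

(** Substitute [v] for the variables where [a] is 1 and [u] for the others: only
the value of the resulting operation at (1,0) is open, and its two possible values
give [nlt] and addition. *)
Lemma nonconstant_clone (C : set Omega) (n : nat) (f : bfun n.+1)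
    (a : {ffun 'I_n.+1 -> bool}) :
  clone C -> C (fn f) -> f [ffun=> false] = false -> f [ffun=> true] = false ->
  f a -> zero_type C.
Proof.
move=> cC Cf f0 f1 fa.
pose o u v := f [ffun i => if a i then v else u].
have Co : closed_op C o.
  apply: (closed_op_subst cC Cf) => i.
  by case: (a i); [exact: closed_op_right|exact: closed_op_left].
have o00 : o false false = false.
  by rewrite -f0; congr (f _); apply/ffunP => i; rewrite !ffunE if_same.
have o11 : o true true = false.
  by rewrite -f1; congr (f _); apply/ffunP => i; rewrite !ffunE if_same.
have o01 : o false true = true.
  by rewrite -[RHS]fa; congr (f _); apply/ffunP => i; rewrite ffunE; case: (a i).
case o10: (o true false).
  apply: addb_clone cC _; apply: closed_op_ext Co.
  by case; case.
apply: nlt_clone cC _; apply: closed_op_ext Co.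
by case; case.
Qed.

(** * Duals of linear and constant-preserving clones *)

Lemma dual_setT : dual @` setT = setT.
Proof. by apply/seteqP; split=> f // _; apply/mem_dual. Qed.

Lemma dual_Omega_0s : dual @` Omega_0s = Omega_s1.
Proof.
have e n : [ffun i : 'I_n => ~~ [ffun=> false] i] = [ffun=> true].
  by apply/ffunP => i; rewrite !ffunE.
apply/seteqP; split=> -[n f]; rewrite mem_dual /Omega_0s /Omega_s1 /= /op /=.
  by rewrite ffunE e => /negbFE.
by rewrite ffunE e => ->.
Qed.

Lemma dual_L : dual @` L = L.
Proof.
suff LL : dual @` L `<=` L.
  apply/seteqP; split=> // f Lf; apply/mem_dual/LL/mem_dual.
  by rewrite dualK.
move=> f /mem_dual; rewrite -{2}[f]dualK.
case: (dual f) => n g [S [c gE]] {f}.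
(* Negating the [#|S|] variables adds [#|S|] modulo 2 to the sum, and negating the
   result changes [c]. *)
exists S, (~~ c (+) (\big[addb/false]_(i in S) true)) => x.
rewrite [LHS]ffunE [g _]gE.
have -> : \big[addb/false]_(i in S) [ffun i => ~~ x i] i =
    \big[addb/false]_(i in S) x i (+) \big[addb/false]_(i in S) true.
  by rewrite -big_split; apply: eq_bigr => i _; rewrite ffunE /= addbT.
by rewrite -addbA -!addbN (addbC (~~ c)).
Qed.

Lemma dual_L_0s : dual @` L_0s = L_s1.
Proof.
rewrite /L_0s /L_s1 -{2}dual_L -dual_Omega_0s.
apply/seteqP; split=> f; first by move=> /mem_dual[? ?]; split; exact/mem_dual.
by move=> [/mem_dual ? /mem_dual ?]; apply/mem_dual.
Qed.

(** * Composition-closed classes *)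

Lemma closed_class_clone (K : set Omega) (n : nat) (i : 'I_n.+1) :
  closed_classes K -> K (fn (projection i)) -> clone K.
Proof.
move=> [eK cK] Ki; split=> // _ [m [j ->]].
by apply: eK Ki; exists (fun=> j) => x; rewrite !ffunE.
Qed.

(** If the two values differ, the diagonal of [f], a unary subfunction, is the
identity or the negation; the negation composed with itself is the identity. *)
Lemma no_projection_diagonal (K : set Omega) (n : nat) (f : bfun n.+1) :
  closed_classes K -> ~ K (fn (projection (ord0 : 'I_1))) -> K (fn f) ->
  f [ffun=> false] = f [ffun=> true].
Proof.
move=> [eK cK] Kid Kf.
pose d : bfun 1 := [ffun x : {ffun 'I_1 -> bool} => f [ffun=> x ord0]].
have Kd : K (fn d).
  by apply: eK Kf; exists (fun=> ord0) => x; rewrite ffunE.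
case f0: (f [ffun=> false]); case f1: (f [ffun=> true]) => //; case: Kid.
  have := cK _ _ _ _ Kd (fun=> Kd); congr (K (fn _)).
  by apply/ffunP => x; rewrite !ffunE; case: (x ord0); rewrite ?f0 ?f1.
move: Kd; congr (K (fn _)).
by apply/ffunP => x; rewrite !ffunE; case: (x ord0).
Qed.

Lemma constantsP (c : bool) (F : Omega) :
  constants c F <-> forall x, op F x = c.
Proof.
split=> [[m ->] x|]; first by rewrite /op /= ffunE.
case: F => n f fc; exists n; congr (fn _).
by apply/ffunP => x; rewrite ffunE; exact: fc.
Qed.

Lemma projectionsP (F : Omega) :
  projections F <-> exists i, forall x : {ffun _ -> bool}, op F x = x i.
Proof.
split=> [[m [i ->]]|]; first by exists i => x; rewrite /op /= ffunE.
case: F => n f [i fi]; exists n, i; congr (fn _).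
by apply/ffunP => x; rewrite ffunE; exact: fi.
Qed.

Definition constants_in (B : set bool) : set Omega :=
  \bigcup_(c in B) constants c.

Lemma constants_clone (B : set bool) : clone (constants_in B `|` projections).
Proof.
split=> [n k f g|]; last exact: subsetUr.
case=> [[c Bc /constantsP fc] _|/projectionsP[i fi] Kg].
  by left; exists c => //; apply/constantsP => x; rewrite /op /= ffunE; exact: fc.
suff -> : composition f g = g i by exact: Kg.
by apply/ffunP => x; rewrite ffunE [LHS]fi ffunE.
Qed.

(** A class containing one constant function contains, by equationality, the
constant functions of all arities with that value. *)
Lemma generated_by_constants (K : set Omega) :
  closed_classes K -> K `<=` constants_in setT ->
  generated_clone K = constants_in [set c | constants c `&` K !=set0] `|` projections.
Proof.
move=> [eK _] Kc; apply/seteqP; split.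
  apply: smallest_sub; first exact: constants_clone.
  by move=> f Kf; left; have [c _ fc] := Kc f Kf; exists c => //; exists f.
move=> f fB M [cM KM]; case: fB => [[c [[m g] [/constantsP gc Kg]] fc]|pf].
  apply: KM; case: f fc => n f /constantsP fc; apply: eK Kg.
  by exists (fun=> ord0) => x; rewrite [LHS]fc [RHS]gc.
by case: cM => _; apply.
Qed.

Lemma constants_in_cases (B : set bool) :
  [\/ constants_in B = set0, constants_in B = constants false,
      constants_in B = constants true |
      constants_in B = constants false `|` constants true].
Proof.
have BE b c : ~ B c -> (forall d, d != c -> B d) -> b != c ->
    constants_in B = constants b.
  move=> nBc Bd bc; apply/seteqP; split=> [f [d Bd' fd]|f fb].
    by case: (eqVneq d c) => [dc|dc]; [case: nBc; rewrite -dc|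
       have -> : b = d by case: (b) (c) (d) bc dc => [] [] []].
  by exists b => //; exact: Bd.
have [Bf|Bf] := pselect (B false); have [Bt|Bt] := pselect (B true).
- constructor 4; apply/seteqP; split=> [f [[] _ fc]|f [] fc].
  + by right.
  + by left.
  + by exists false.
  + by exists true.
- by constructor 2; apply: (BE _ _ Bt) => // -[].
- by constructor 3; apply: (BE _ _ Bf) => // -[].
- constructor 1; apply/seteqP; split=> // f [[] //].
Qed.

(** * The classes that generate a given clone *)

Unset Implicit Arguments.

Theorem corollary3p10 (C : set Omega)
  (cloneC : clone C)
  (C_neq_id : C <> projections)
  (C_neq_0id : C <> constants false `|` projections)
  (C_neq_1id : C <> constants true `|` projections)
  (C_neq_01id : C <> constants false `|` constants true `|` projections)
  (C_neq_Omega : C <> [set: Omega])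
  (C_neq_Omega0 : C <> Omega_0s)
  (C_neq_Omega1 : C <> Omega_s1)
  (C_neq_L : C <> L)
  (C_neq_L0 : C <> L_0s)
  (C_neq_L1 : C <> L_s1)
  (C_neq_W : forall k : nat, 2 <= k -> C <> W k)
  (C_neq_Winf : C <> W_inf)
  (C_neq_U : forall k : nat, 2 <= k -> C <> U k)
  (C_neq_Uinf : C <> U_inf) :
  closed_classes_of C = [set C].
Proof.
apply/seteqP; split=> [K [cK KC]|_ ->]; last first.
  split; first by split; [exact: clone_equational|exact: cloneC.1].
  by apply/seteqP; split; [exact: smallest_sub|exact: sub_gen_smallest].
have KsubC : K `<=` C by rewrite -KC; exact: sub_gen_smallest.
have [Kid|nKid] := pselect (K (fn (projection (ord0 : 'I_1)))).
  apply/seteqP; split=> //; rewrite -KC; apply: smallest_sub => //.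
  exact: closed_class_clone Kid.
have [Kc|] := pselect (K `<=` constants_in setT).
  have := generated_by_constants cK Kc; rewrite KC.
  set B := [set c | _].
  by case: (constants_in_cases B) => -> // CE; case: C_neq_id; rewrite CE set0U.
move=> /existsNP[[n f] /not_implyP[Kf fnc]].
have Cf := KsubC _ Kf.
have f01 := no_projection_diagonal cK nKid Kf.
have [a fa] : exists a, f a != f [ffun=> false].
  apply: contrapT => /forallNP na; apply: fnc.
  exists (f [ffun=> false]) => //; apply/constantsP => x.
  by have /negP/negPn/eqP := na x.
case f0: (f [ffun=> false]) f01 fa => /esym f1 fa.
  (* The common value at the constant tuples is 1, so the dual of [f] is used. *)
  have : zero_type (dual @` C).
    pose f' : bfun n.+1 := [ffun x : {ffun _ -> bool} => ~~ f [ffun i => ~~ x i]].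
    have neg c : f' [ffun=> c] = ~~ f [ffun=> ~~ c].
      by rewrite ffunE; congr (~~ f _); apply/ffunP => i; rewrite !ffunE.
    apply: (nonconstant_clone (f := f') (a := [ffun i => ~~ a i]) (dual_clone cloneC)).
    - by exists (fn f).
    - by rewrite neg f1.
    - by rewrite neg f0.
    - move: fa; rewrite eqb_id ffunE; congr (~~ (f _)).
      by apply/ffunP => i; rewrite !ffunE negbK.
  case=> [[]|[[k k2]|]] /eq_dual CE.
  - by case: C_neq_Omega; rewrite CE dual_setT.
  - by case: C_neq_Omega1; rewrite CE dual_Omega_0s.
  - by case: C_neq_L; rewrite CE dual_L.
  - by case: C_neq_L1; rewrite CE dual_L_0s.
  - by case: (C_neq_W k k2); rewrite CE /U; apply/esym/eq_dual.
  - by case: C_neq_Winf; rewrite CE /U_inf; apply/esym/eq_dual.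
have fa' : f a by move: fa; rewrite eqbF_neg negbK.
by case: (nonconstant_clone cloneC Cf f0 f1 fa') => [[]|[[k k2]|]] // /(C_neq_U k k2).
Qed.
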